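(* Let $k\ge1$, $N,J\in\mathbb N$, $h=1/N$, $T>0$, $\tau=T/J$, let $u_h^0\in S^k_{h,0}$, and let $(u_h^j)_{1\le j\le J}\subset S^k_{h,0}$ be the solution of the discrete problem $$\left(\frac{u_h^{j+1}-u_h^j}{\tau},v_h\right)_{0,r}+(u_h^{j+1},v_h)_{H^1_r}=\left(\frac{f(u_h^j)}{r^2},v_h\right)_{0,r}\quad\text{for all }v_h\in S^k_{h,0},\qquad j=0,\dots,J-1 .$$ If $u_h^0\in\mathcal E_1$, then $$\|u_h^j\|_{L^\infty(I)}\le\pi,\qquad 0\le j\le J .$$
   Context: $I=[0,1]$. $(v,w)_{0,r}=\int_0^1 v(r)w(r)\,r\,dr$ and $(v,w)_{H^1_r}=(\partial_r v,\partial_r w)_{0,r}+\left(\frac vr,\frac wr\right)_{0,r}$, with corresponding norms $\|\cdot\|_{0,r}$, $\|\cdot\|_{H^1_r}$. $H^1_{r,0}=\{v:I\to\mathbb R:\ \|v\|_{0,r}<\infty,\ \|v\|_{H^1_r}<\infty,\ v(0)=v(1)=0\}$. The energy is $\mathcal E(v)=\frac12\int_0^1\left((\partial_r v)^2+\frac{\sin^2 v}{r^2}\right)r\,dr$, and $\mathcal E_1=\{v\in H^1_{r,0}:\ \mathcal E(v)\le2\}$. Further $f(v)=v-\frac12\sin(2v)$. For $h=1/N$ and grid points $r_i=ih$, $i=0,\dots,N$, $S^k_{h,0}$ is the space of continuous functions $v$ on $I$ with $v(0)=v(1)=0$ whose restriction to each $[r_i,r_{i+1}]$ is a polynomial of degree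 at most $k$. The discrete problem is a linear problem in each time step and has a unique solution. *)

(* Defs.v *)
From mathcomp Require Import all_boot all_order all_algebra.
From mathcomp Require Import all_classical all_reals all_analysis.

Set Implicit Arguments.
Unset Strict Implicit.
Unset Printing Implicit Defensive.

Import Order.TTheory GRing.Theory Num.Theory.
Import numFieldNormedType.Exports.

Local Open Scope classical_set_scope.
Local Open Scope ring_scope.

(* Functions on I = [0, 1] are represented by total functions R -> R whose
   values outside I are irrelevant: these affect the derivative only at the
   endpoints 0 and 1, a null set for the integrals over I. *)

Section HarmonicMapHeatFlow.
Context {R : realType}.
Local Notation mu := (@lebesgue_measure R).
Implicit Types (u v w g phi : R -> R).

(* (v, w)_{0,r}. Inner products and norms take values in the extended reals, so
   that finiteness of a norm is a genuine condition. The quotients by r below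
   are evaluated with 0^-1 = 0 at r = 0, a null set. *)
Definition dot0r v w : \bar R :=
  (\int[mu]_(r in `[0%R, 1%R]) (v r * w r * r)%:E)%E.

(* (v, w)_{H^1_r}. The radial derivative is the pointwise derivative derive1 v:
   for the functions in H1r0 (hence for finite element functions) it exists
   almost everywhere and is the weak derivative. *)
Definition dotH1r v w : \bar R :=
  (dot0r (derive1 v) (derive1 w) +
   dot0r (fun r => (v r / r)%R) (fun r => (w r / r)%R))%E.

Definition norm0r v : \bar R := sqrte (dot0r v v).

Definition normH1r v : \bar R := sqrte (dotH1r v v).

Definition test_function phi : Prop :=
  (forall (n : nat) (x : R), derivable (derive1n n phi) x 1) /\
  (exists a b : R, [/\ 0 < a, b < 1 & forall x, x \notin `[a, b] -> phi x = 0]).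

Definition weak_derivative v g : Prop :=
  (forall a b : R, 0 < a -> b < 1 -> mu.-integrable `[a, b] (EFin \o g)) /\
  (forall phi, test_function phi ->
    (\int[mu]_(r in `[0%R, 1%R]) (v r * derive1 phi r)%:E =
     - \int[mu]_(r in `[0%R, 1%R]) (g r * phi r)%:E)%E).

(* H^1_{r,0}. A weakly differentiable v with finite normH1r has a unique
   representative continuous on [0, 1]; the boundary values, the pointwise
   derivative and membership refer to this representative. *)
Definition H1r0 : set (R -> R) := [set v : R -> R |
  [/\ {within `[0%R, 1%R], continuous v}, weak_derivative v (derive1 v),
      (norm0r v < +oo)%E, (normH1r v < +oo)%E & v 0 = 0 /\ v 1 = 0]].

Definition energy v : \bar R :=
  ((2^-1)%:E * \int[mu]_(r in `[0%R, 1%R])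
     (((derive1 v r) ^+ 2 + (sin (v r)) ^+ 2 / r ^+ 2) * r)%:E)%E.

Definition energy_class1 : set (R -> R) :=
  [set v : R -> R | H1r0 v /\ (energy v <= 2%:E)%E].

Definition f_nonlin (x : R) : R := x - 2^-1 * sin (2 * x).

(* S^k_{h,0} with h = 1/N *)
Definition Skh0 (k N : nat) : set (R -> R) := [set v : R -> R |
  [/\ {within `[0%R, 1%R], continuous v}, v 0 = 0, v 1 = 0 &
    forall i : nat, (i < N)%N ->
      exists p : {poly R}, (size p <= k.+1)%N /\
        forall r, r \in `[i%:R / N%:R, i.+1%:R / N%:R] -> v r = p.[r]]].

Definition scheme_step (k N : nat) (tau : R) u w : Prop :=
  forall v, Skh0 k N v ->
    (dot0r (fun r => ((w r - u r) / tau)%R) v + dotH1r w v =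
     dot0r (fun r => (f_nonlin (u r) / r ^+ 2)%R) v)%E.

Definition is_discrete_solution (k N J : nat) (T : R) (u : nat -> R -> R)
    : Prop :=
  (forall j, (j <= J)%N -> Skh0 k N (u j)) /\
  (forall j, (j < J)%N -> scheme_step k N (T / J%:R) (u j) (u j.+1)).

Definition normLinf v : \bar R :=
  Lnorm (mrestr mu (measurable_itv `[0 : R, 1])) +oo%E (EFin \o v).

End HarmonicMapHeatFlow.

(* Main.v *)
Require Import Defs.
From mathcomp Require Import all_boot all_order all_algebra.
From mathcomp Require Import all_classical all_reals all_analysis.
From mathcomp Require Import measurable_realfun ess_sup_inf ring lra.
Set Implicit Arguments.
Unset Strict Implicit.
Unset Printing Implicit Defensive.

Import Order.TTheory GRing.Theory Num.Theory.
Import numFieldNormedType.Exports.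
Local Open Scope classical_set_scope.
Local Open Scope ring_scope.

(** The scheme is a convex splitting of the energy. Up to a factor 1/2 the
energy is the square of the H^1_r norm minus the integral of
(v^2 - sin^2 v) / r, and the primitive (x^2 - sin^2 x) / 2 of [f_nonlin] is
convex. Treating the convex quadratic part implicitly and the subtracted convex
part explicitly makes the energy nonincreasing for every step size: testing
one step from [a] to [b] with [b - a] gives
E(b) - E(a) <= - |b - a|_{0,r}^2 / tau <= 0 ([scheme_step_energy_le]). So every
iterate has energy at most 2.

The energy controls the amplitude by the Bogomolny inequality
|sin v . v'| <= (v'^2 + sin^2 v / r^2) r / 2, whose left-hand side is the modulus
of the derivative of cos v. Since v vanishes at both ends of [0, 1], integrating
from 0 to r and from r to 1 yields 2 (1 - cos (v r)) <= E(v) <= 2, i.e.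
cos (v r) >= 0 for every r ([energy_le4_normr_lt_pi]). A continuous function
starting from 0 cannot reach modulus pi, where the cosine is -1, and the bound
follows from the intermediate value theorem.

All integrands are bounded and measurable, being pieced together from finitely
many continuous functions; near r = 0 this uses that a polynomial vanishing
at 0 is divisible by r. *)

(** * The nonlinearity and its convex primitive *)

Section trigonometry.
Context {R : realType}.
Implicit Types x y : R.

Lemma normr_sin_le x : `|sin x| <= `|x|.
Proof.
have H y : 0 < y -> `|sin y| <= `|y|.
  move=> y0.
  have [//|c _] := @MVT R sin cos 0 y y0 (fun x _ => is_derive_sin x).
    by apply: continuous_subspaceT; exact: continuous_sin.
  rewrite sin0 !subr0 => ->; rewrite normrM ler_piMl//.
  by rewrite ler_norml cos_geN1 cos_le1.
have [x0|x0|->] := ltgtP x 0; [|exact: H|by rewrite sin0].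
by rewrite -(normrN x) -(normrN (sin x)) -sinN H// oppr_gt0.
Qed.

(** The increment of [f_nonlin] equals [d - sin d * cos (x + y)] with
[d = y - x], and [`|sin d| <= d]. *)
Lemma f_nonlin_mono x y : x <= y -> f_nonlin x <= f_nonlin y.
Proof.
move=> xy; rewrite -subr_ge0.
have -> : f_nonlin y - f_nonlin x = (y - x) - sin (y - x) * cos (y + x).
  have s2 z : sin (2 * z) = 2 * (cos z * sin z).
    by rewrite (mulrC 2 z) mulr_natr sin_mulr2n -mulr_natl.
  rewrite /f_nonlin !s2 sinB cosD.
  have := cos2sin2 x; have := cos2sin2 y; rewrite !expr2 => hy hx.
  have -> : (sin y * cos x - cos y * sin x) * (cos y * cos x - sin y * sin x) =
    sin y * cos y * ((cos x * cos x) + sin x * sin x) -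
    sin x * cos x * ((cos y * cos y) + sin y * sin y) by ring.
  by rewrite hx hy; field.
rewrite subr_ge0 -[leRHS]ger0_norm ?subr_ge0//.
apply: le_trans (ler_norm _) _; rewrite normrM.
apply: le_trans (normr_sin_le _); apply: ler_piMr => //.
by rewrite ler_norml cos_geN1 cos_le1.
Qed.

Lemma normr_f_nonlin_le x : `|f_nonlin x| <= 2 * `|x|.
Proof.
rewrite /f_nonlin (le_trans (ler_normB _ _))// normrM (ger0_norm (_ : 0 <= 2^-1))//.
have := normr_sin_le (2 * x); rewrite normrM (ger0_norm (_ : 0 <= 2 :> R))//.
lra.
Qed.

Definition f_primitive x : R := 2^-1 * (x ^+ 2 - sin x ^+ 2).

Lemma is_derive_f_primitive x : is_derive x 1 f_primitive (f_nonlin x).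
Proof.
rewrite /f_primitive; apply: trigger_derive.
rewrite /f_nonlin (mulrC 2 x) mulr_natr sin_mulr2n -mulr_natl /GRing.scale/=.
by field.
Qed.

(** The tangent inequality of a function whose derivative is monotone: by the
mean value theorem the slope of the chord is [f_nonlin c] for some [c] between
the two points. *)
Lemma f_primitive_convex x y :
  f_nonlin x * (y - x) <= f_primitive y - f_primitive x.
Proof.
have H a b : a < b -> exists2 c, a <= c <= b &
    f_primitive b - f_primitive a = f_nonlin c * (b - a).
  move=> ab.
  have [//||c cab Hc] := @MVT R f_primitive f_nonlin a b ab.
  - by move=> z _; exact: is_derive_f_primitive.
  - apply: derivable_within_continuous => z _.
    by apply: ex_derive; exact: is_derive_f_primitive.
  - by exists c => //; move: cab; rewrite in_itv/= => /andP[/ltW -> /ltW ->].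
have [xy|yx|->] := ltgtP x y; last by rewrite !subrr mulr0.
- have [c /andP[xc _] ->] := H _ _ xy.
  by rewrite ler_wpM2r ?f_nonlin_mono// subr_ge0 ltW.
- have [c /andP[_ cx] Hc] := H _ _ yx.
  rewrite -lerN2 opprB Hc -mulrN opprB.
  by rewrite ler_wpM2r ?f_nonlin_mono// subr_ge0 ltW.
Qed.

End trigonometry.

(** * Bounded measurable functions *)

Section bounded_measurable.
Context {R : realType}.
Local Notation mu := (@lebesgue_measure R).
Implicit Types (A B : set R) (g h : R -> R).

(** On bounded intervals this implies integrability; unlike integrability it
is stable under products. *)
Definition bounded_measurable A g :=
  measurable_fun A g /\ exists M, forall x, A x -> `|g x| <= M.

Local Notation bm := bounded_measurable.

Lemma bm_eq A g h : {in A, g =1 h} -> bm A g -> bm A h.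
Proof.
move=> gh [mg [M gM]]; split; first exact: eq_measurable_fun mg.
by exists M => x Ax; rewrite -gh ?inE//; exact: gM.
Qed.

Lemma bm_set1 x g : bm [set x] g.
Proof.
by split; [exact: measurable_fun_set1|exists `|g x| => _ ->].
Qed.

Lemma bmU A B g : measurable A -> measurable B ->
  bm A g -> bm B g -> bm (A `|` B) g.
Proof.
move=> mA mB [mgA [M gM]] [mgB [M' gM']]; split; first exact/measurable_funU.
exists (Num.max M M') => x [/gM|/gM'] gx; rewrite le_max gx ?orbT//.
Qed.

Lemma bmS A B g : measurable B -> A `<=` B -> bm B g -> bm A g.
Proof.
move=> mB AB [mg [M gM]]; split; first exact: measurable_funS mg.
by exists M => x /AB; exact: gM.
Qed.

Lemma bm_continuous a b g : {within `[a, b], continuous g} -> bm `[a, b] g.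
Proof.
move=> cg; split; first exact: subspace_continuous_measurable_fun.
have /compact_bounded[M [_ gM]] :=
  continuous_compact cg (@segment_compact _ a b).
by exists (M + 1) => x xab; apply: (gM (M + 1)); [rewrite ltrDl|exists x].
Qed.

Lemma bm_id a b : bm `[a, b] (fun x : R => x).
Proof. by apply: bm_continuous; by apply: continuous_subspaceT => x. Qed.

Lemma bm_cst A c : bm A (fun=> c).
Proof. by split; [exact: measurable_cst|exists `|c|]. Qed.

Lemma bmM A g h : bm A g -> bm A h -> bm A (fun x => g x * h x).
Proof.
move=> [mg [M gM]] [mh [M' hM]]; split; first exact: measurable_funM.
by exists (M * M') => x Ax; rewrite normrM ler_pM ?gM ?hM.
Qed.

Lemma bmD A g h : bm A g -> bm A h -> bm A (fun x => g x + h x).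
Proof.
move=> [mg [M gM]] [mh [M' hM]]; split; first exact: measurable_funD.
by exists (M + M') => x Ax; rewrite (le_trans (ler_normD _ _))// lerD ?gM ?hM.
Qed.

Lemma bmN A g : bm A g -> bm A (fun x => - g x).
Proof.
move=> /(bmM (bm_cst A (-1))); apply: bm_eq => x _.
by rewrite mulN1r.
Qed.

Lemma bmB A g h : bm A g -> bm A h -> bm A (fun x => g x - h x).
Proof. by move=> bg bh; apply: bmD => //; exact: bmN. Qed.

Lemma bmX A g n : bm A g -> bm A (fun x => g x ^+ n).
Proof.
move=> bg; elim: n => [|n ih]; first exact: bm_cst.
by apply: bm_eq (bmM bg ih) => x _; rewrite exprS.
Qed.

Lemma bm_integrable a b g : bm `[a, b] g -> mu.-integrable `[a, b] (EFin \o g).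
Proof.
move=> [mg [M gM]]; apply: measurable_bounded_integrable => //.
  by rewrite /= lebesgue_measure_itv/=; case: ifP; rewrite ?ltry// -EFinB ltry.
exists M; split; first by rewrite num_real.
by move=> M' MM' x xab; exact: le_trans (gM x xab) (ltW MM').
Qed.

Lemma bm_integral a b g : bm `[a, b] g ->
  (\int[mu]_(x in `[a, b]) (g x)%:E)%E = (\int[mu]_(x in `[a, b]) g x)%:E.
Proof.
move=> /bm_integrable ig; rewrite /Rintegral fineK//.
by apply: integrable_fin_num.
Qed.

Lemma measurable_inv01 : measurable_fun (`[0, 1] : set R) (@GRing.inv R).
Proof.
rewrite -(@setU1itv _ _ _ 0 false) ?bnd_simp//.
apply/measurable_funU => //; split; first exact: measurable_fun_set1.
apply: subspace_continuous_measurable_fun => //.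
apply: continuous_in_subspaceT => x; rewrite inE/= in_itv/= => /andP[x0 _].
by apply: inv_continuous; rewrite gt_eqF.
Qed.

(** Gives access to quotients such as [sin (v r) / r], which inherit their
boundedness at 0 from [v r / r]. *)
Lemma bm_div_dominated (c : R) g h : (forall x, `|g x| <= c * `|h x|) ->
  measurable_fun (`[0, 1] : set R) g -> 0 <= c -> bm `[0, 1] (fun x => h x / x) ->
  bm `[0, 1] (fun x => g x / x).
Proof.
move=> gh mg c0 [_ [M hM]]; split.
  by apply: measurable_funM => //; exact: measurable_inv01.
exists (c * M) => x /hM; rewrite !normrM => hx.
by rewrite (le_trans (ler_wpM2r _ (gh x)))// -mulrA ler_wpM2l.
Qed.

(** The values at the grid points are unconstrained, which is what the
pointwise derivative of a finite element function requires. *)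
Lemma bm_piecewise (N : nat) g : (0 < N)%N ->
  (forall i, (i < N)%N -> exists c : R -> R,
     {within `[i%:R / N%:R, i.+1%:R / N%:R], continuous c} /\
     {in `]i%:R / N%:R, i.+1%:R / N%:R[, g =1 c}) ->
  bm `[0, 1] g.
Proof.
move=> N0 gc.
have Nr : (0 : R) < N%:R by rewrite ltr0n.
suff H n : (n <= N)%N -> bm `[0, n%:R / N%:R] g.
  by have := H N (leqnn N); rewrite divff// gt_eqF.
elim: n => [_|n ih nN].
  by rewrite mul0r set_itv1; exact: bm_set1.
have [c [cc gcE]] := gc n nN.
have lt_nn1 : n%:R / N%:R < n.+1%:R / N%:R :> R by rewrite ltr_pM2r ?invr_gt0// ltr_nat.
rewrite (@itv_bndbnd_setU _ _ _ (BRight (n%:R / N%:R))) ?bnd_simp; last 2 first.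
- by rewrite divr_ge0.
- exact: ltW.
apply: bmU => //; first exact/ih/ltnW.
rewrite -(@setUitv1 _ _ _ _ true) ?bnd_simp//.
apply: bmU => //; last exact: bm_set1.
apply: (@bm_eq _ c); first by move=> x; rewrite inE => xn; rewrite gcE.
apply: bmS (bm_continuous cc) => //.
exact: subset_itv_oo_cc.
Qed.

End bounded_measurable.

(** * Finite element functions *)

Section finite_elements.
Context {R : realType} (k N : nat) (N0 : (0 < N)%N).
Local Notation mu := (@lebesgue_measure R).
Local Notation node i := (i%:R / N%:R : R).
Local Notation bm := bounded_measurable.
Implicit Types u v w : R -> R.

Lemma node_lt i : node i < node i.+1.
Proof. by rewrite ltr_pM2r ?invr_gt0 ?ltr0n// ltr_nat. Qed.

(** At the grid points the one-sided derivatives may differ, hence the open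
interval in the second clause. *)
Lemma Skh0_cell v i : Skh0 k N v -> (i < N)%N -> exists p : {poly R},
  {in `[node i, node i.+1], v =1 horner p} /\
  {in `]node i, node i.+1[, derive1 v =1 horner p^`()}.
Proof.
move=> [_ _ _ vp] /vp[p [_ vpE]]; exists p; split => // x xi.
rewrite derivE !derive1E; apply: near_eq_derive.
near=> y; apply: vpE; apply: subset_itv_oo_cc.
near: y; exact: near_in_itvoo.
Unshelve. all: by end_near. Qed.

Lemma Skh0B v w : Skh0 k N v -> Skh0 k N w -> Skh0 k N (fun x => v x - w x).
Proof.
move=> [cv v0 v1 vp] [cw w0 w1 wp]; split.
- by move=> x; apply: cvgB; [exact: cv|exact: cw].
- by rewrite v0 w0 subrr.
- by rewrite v1 w1 subrr.
move=> i iN; have [p [sp vpE]] := vp _ iN; have [q [sq wqE]] := wp _ iN.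
exists (p - q); split.
  by rewrite (leq_trans (size_polyD _ _))// size_polyN geq_max sp sq.
by move=> r ri; rewrite vpE// wqE// hornerD hornerN.
Qed.

Lemma Skh0_bm v : Skh0 k N v -> bm `[0, 1] v.
Proof. by case=> cv *; exact: bm_continuous. Qed.

Lemma Skh0_derive1_bm v : Skh0 k N v -> bm `[0, 1] (derive1 v).
Proof.
move=> Sv; apply: (bm_piecewise N0) => i iN.
have [p [_ dvp]] := Skh0_cell Sv iN.
exists (horner p^`()); split => //.
by apply: continuous_subspaceT; exact: continuous_horner.
Qed.

(** Away from the first cell [r^-1] is continuous; in the first cell the
polynomial vanishes at 0, so the quotient is again a polynomial. *)
Lemma Skh0_div_bm v : Skh0 k N v -> bm `[0, 1] (fun r => v r / r).
Proof.
move=> Sv; apply: (bm_piecewise N0) => i iN.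
have [p [vp _]] := Skh0_cell Sv iN.
have vp' x : x \in `]node i, node i.+1[ -> v x = p.[x].
  by move=> xi; apply: vp; exact: subset_itv_oo_cc.
case: i => [|i] in iN vp vp' *.
- have : root p 0.
    case: (Sv) => _ v0 _ _; apply/rootP; rewrite -vp// in_itv/= mul0r lexx.
    by rewrite divr_ge0.
  move=> /factor_theorem[q pq]; exists (horner q); split.
    by apply: continuous_subspaceT; exact: continuous_horner.
  move=> x xi; rewrite vp'// pq subr0 hornerMX mulfK//.
  by move: xi; rewrite in_itv/= mul0r => /andP[/gt_eqF ->].
- exists (fun x => p.[x] / x); split; last by move=> x /vp' ->.
  apply: continuous_in_subspaceT => x; rewrite inE/= in_itv/= => /andP[ix _].
  apply: cvgM; first exact: continuous_horner.
  apply: inv_continuous; rewrite gt_eqF// (lt_le_trans _ ix)// divr_gt0//.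
  by rewrite ltr0n.
Qed.

(** Only almost everywhere: at a grid point the derivative of the difference
may exist although [v] and [w] both have a kink there. *)
Lemma Skh0_derive1B v w : Skh0 k N v -> Skh0 k N w ->
  \forall x \ae mu, x \in `[0 : R, 1] ->
    derive1 (fun x => v x - w x) x = derive1 v x - derive1 w x.
Proof.
move=> Sv Sw.
pose G := [set node i | i in `I_N.+1].
have cG : countable G.
  by apply: finite_set_countable; apply: finite_image; exact: finite_II.
exists G; split.
- by apply: countable_measurable => // x; exact: measurable_set1.
- exact: countable_lebesgue_measure0.
move=> x /= /not_implyP[]; rewrite in_itv/= => /andP[x0 x1] nE.
have Nr : (0 : R) < N%:R by rewrite ltr0n.
(* the index of the cell containing [x] *)
pose i := Num.truncn (x * N%:R).
have /truncn_itv/andP[ix xi] : 0 <= x * N%:R by rewrite mulr_ge0.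
rewrite -ler_pdivrMr// in ix.
rewrite -ltr_pdivlMr// in xi.
have iN : (i <= N)%N.
  by rewrite -(ler_nat R) -(ler_pM2r (_ : 0 < N%:R^-1)) ?invr_gt0// (le_trans ix)// divff// gt_eqF.
exists i; first by rewrite /= ltnS.
apply/eqP; rewrite eq_le ix leNgt; apply/negP => ltix; apply: nE.
have {}iN : (i < N)%N.
  by rewrite -(ltr_nat R) -(ltr_pM2r (_ : 0 < N%:R^-1)) ?invr_gt0// (lt_le_trans ltix)// divff// gt_eqF.
have xI : x \in `]node i, node i.+1[ by rewrite in_itv/= ltix.
have [p [vp _]] := Skh0_cell Sv iN.
have [q [wq _]] := Skh0_cell Sw iN.
have dv g h : {in `[node i, node i.+1], g =1 horner h} -> derivable g x 1.
  move=> gh; apply: (@near_eq_derivable _ _ _ (horner h)); last exact: derivable_horner.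
  near=> y; apply/esym/gh; apply: subset_itv_oo_cc.
  by near: y; exact: near_in_itvoo.
by rewrite !derive1E deriveB//; [exact: dv vp|exact: dv wq].
Unshelve. all: by end_near. Qed.

End finite_elements.

(** * Decay of the energy *)

Section energy_decay.
Context {R : realType} (k N : nat) (N0 : (0 < N)%N).
Local Notation mu := (@lebesgue_measure R).
Local Notation bm := bounded_measurable.
Implicit Types u v w : R -> R.

Definition energy_density v r :=
  ((derive1 v r) ^+ 2 + (sin (v r)) ^+ 2 / r ^+ 2) * r.

Lemma energy_density_ge0 v r : 0 <= r -> 0 <= energy_density v r.
Proof. by move=> r0; rewrite mulr_ge0// addr_ge0 ?divr_ge0 ?sqr_ge0. Qed.

Lemma energy_density_bm v : Skh0 k N v -> bm `[0, 1] (energy_density v).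
Proof.
move=> Sv.
have bs : bm `[0, 1] (fun r => sin (v r) / r).
  apply: (@bm_div_dominated _ 1 (sin \o v) v) => //.
  - by move=> x; rewrite mul1r; exact: normr_sin_le.
  - apply: measurableT_comp; last by have [] := Skh0_bm Sv.
    by apply: continuous_measurable_fun; exact: continuous_sin.
  - exact: Skh0_div_bm Sv.
apply: bm_eq (bmM (bmD (bmX 2 (Skh0_derive1_bm N0 Sv)) (bmX 2 bs)) (bm_id 0 1)).
by move=> r _; rewrite /energy_density expr_div_n.
Qed.

Lemma Skh0_energyE v : Skh0 k N v ->
  energy v = (2^-1 * \int[mu]_(r in `[0, 1]) energy_density v r)%:E.
Proof. by move=> /energy_density_bm/bm_integral vE; rewrite EFinM -vE. Qed.

Lemma f_nonlin_div_bm u v : Skh0 k N u -> Skh0 k N v ->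
  bm `[0, 1] (fun r => f_nonlin (u r) / r ^+ 2 * v r * r).
Proof.
move=> Su Sv.
have bf : bm `[0, 1] (fun r => f_nonlin (u r) / r).
  apply: (@bm_div_dominated _ 2 (fun r => f_nonlin (u r)) u) => //.
  - by move=> x; exact: normr_f_nonlin_le.
  - apply: (measurableT_comp (f := f_nonlin)); last by have [] := Skh0_bm Su.
    apply: continuous_measurable_fun => x.
    apply: cvgB => //; apply: cvgM; first exact: cvg_cst.
    apply: (@continuous_cvg _ _ _ _ _ _ sin); first exact: continuous_sin.
    by apply: cvgM => //; exact: cvg_cst.
  - exact: Skh0_div_bm Su.
apply: bm_eq (bmM (bmM bf (Skh0_div_bm N0 Sv)) (bm_id 0 1)) => r _.
by rewrite expr2 invfM; ring.
Qed.

(** The integrand of the energy decay, with [a], [b] the values and [a'], [b']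
the derivatives of the old and new iterates at radius [r]. The quadratic part is
estimated by [b^2 - a^2 <= 2 b (b - a)], which puts it at the new time, the
remaining part by the tangent of [f_primitive] at the old value. At [r = 0] both
sides vanish. *)
Lemma convex_splitting_pointwise (a b a' b' r : R) : 0 <= r ->
  (b' ^+ 2 + sin b ^+ 2 / r ^+ 2) * r - (a' ^+ 2 + sin a ^+ 2 / r ^+ 2) * r <=
  2 * (b' * (b' - a') * r + b / r * ((b - a) / r) * r
       - f_nonlin a / r ^+ 2 * (b - a) * r).
Proof.
move=> r0; have := f_primitive_convex a b; rewrite /f_primitive => ab.
rewrite [leRHS](_ : _ = 2 * (b' * (b' - a') + b / r * ((b - a) / r)
  - f_nonlin a / r ^+ 2 * (b - a)) * r); last by ring.
rewrite -mulrBl; apply: ler_wpM2r => //.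
have -> : b / r * ((b - a) / r) = b * (b - a) / r ^+ 2.
  by rewrite expr2 invfM; ring.
have : 0 <= (r ^+ 2)^-1 by rewrite invr_ge0 sqr_ge0.
move: (r ^+ 2)^-1 => q q0.
have : 0 <= (b' - a') ^+ 2 by exact: sqr_ge0.
have : (sin b ^+ 2 - sin a ^+ 2) * q <= 2 * (b * (b - a) - f_nonlin a * (b - a)) * q.
  apply: ler_wpM2r => //.
  have : 0 <= (b - a) ^+ 2 by exact: sqr_ge0.
  nra.
nra.
Qed.

(** The test function is the increment [z = w - u]; [convex_splitting_pointwise]
then bounds the energy increase by minus the discrete time derivative tested
with [z], which is nonpositive. *)
Lemma scheme_step_energy_le (tau : R) u w : 0 < tau ->
  Skh0 k N u -> Skh0 k N w -> scheme_step k N tau u w ->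
  \int[mu]_(r in `[0, 1]) energy_density w r <=
  \int[mu]_(r in `[0, 1]) energy_density u r.
Proof.
move=> tau0 Su Sw /(_ _ (Skh0B Sw Su)); rewrite /dotH1r /dot0r.
set z := fun x => w x - u x.
have Sz : Skh0 k N z by exact: Skh0B.
have b1 : bm `[0, 1] (fun r => (w r - u r) / tau * z r * r).
  apply: (bmM _ (bm_id _ _)); apply: (bmM _ (Skh0_bm Sz)); apply: (bmM _ (bm_cst _ _)).
  exact: Skh0_bm Sz.
have bd v := @Skh0_derive1_bm R k N N0 v.
have b2 : bm `[0, 1] (fun r => derive1 w r * derive1 z r * r).
  by apply: (bmM _ (bm_id _ _)); exact: bmM (bd _ Sw) (bd _ Sz).
have b2' : bm `[0, 1] (fun r => derive1 w r * (derive1 w r - derive1 u r) * r).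
  by apply: (bmM _ (bm_id _ _)); exact: bmM (bd _ Sw) (bmB (bd _ Sw) (bd _ Su)).
have b3 : bm `[0, 1] (fun r => w r / r * (z r / r) * r).
  by apply: (bmM _ (bm_id _ _)); 
    exact: bmM (Skh0_div_bm N0 Sw) (Skh0_div_bm N0 Sz).
have b4 := f_nonlin_div_bm Su Sz.
have b5 := energy_density_bm Su; have b6 := energy_density_bm Sw.
have -> : (\int[mu]_(r in `[0%R, 1%R]) (derive1 w r * derive1 z r * r)%:E =
    \int[mu]_(r in `[0%R, 1%R])
      (derive1 w r * (derive1 w r - derive1 u r) * r)%:E)%E.
  apply: ae_eq_integral => //.
  - by apply/measurable_EFinP; case: b2.
  - by apply/measurable_EFinP; case: b2'.
  - case: (Skh0_derive1B N0 Sw Su) => G [mG G0 HG]; exists G; split => // r nr.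
    by apply: HG => /= E; apply: nr => /= /E ->.
rewrite !bm_integral// -!EFinD => -[E].
rewrite -subr_le0 -RintegralB//; try exact: bm_integrable.
apply: (@le_trans _ _ (\int[mu]_(r in `[0, 1]) (2 *
    (derive1 w r * (derive1 w r - derive1 u r) * r + w r / r * (z r / r) * r
     - f_nonlin (u r) / r ^+ 2 * z r * r)))).
  apply: le_Rintegral => //.
  - by apply: bm_integrable; exact: bmB.
  - apply: bm_integrable; apply: bmM; first exact: bm_cst.
    by apply: bmB => //; exact: bmD.
  - move=> r; rewrite /= in_itv/= => /andP[r0 _].
    exact: convex_splitting_pointwise.
rewrite RintegralZl//; last by apply: bm_integrable; apply: bmB => //; exact: bmD.
rewrite RintegralB//; try exact: bm_integrable; last first.
  by apply: bm_integrable; exact: bmD.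
rewrite RintegralD//; try exact: bm_integrable.
rewrite -E opprD addrCA subrr addr0.
rewrite mulrN oppr_le0 mulr_ge0//; apply: Rintegral_ge0 => r.
rewrite /= in_itv/= => /andP[r0 _].
by rewrite mulr_ge0// mulrAC -expr2 mulr_ge0 ?sqr_ge0// invr_ge0 ltW.
Qed.

Lemma discrete_solution_energy_le (J : nat) (T : R) (u : nat -> R -> R) j :
  0 < T -> (0 < J)%N -> is_discrete_solution k N J T u -> (j <= J)%N ->
  \int[mu]_(r in `[0, 1]) energy_density (u j) r <=
  \int[mu]_(r in `[0, 1]) energy_density (u 0%N) r.
Proof.
move=> T0 J0 [Su step]; elim: j => // j ih jJ; apply: le_trans (ih (ltnW jJ)).
apply: scheme_step_energy_le (step _ jJ); last exact: Su.
  by rewrite divr_gt0// ltr0n.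
exact/Su/ltnW.
Qed.

End energy_decay.

(** * The energy bounds the amplitude *)

Section energy_bound.
Context {R : realType} (k N : nat) (N0 : (0 < N)%N).
Local Notation mu := (@lebesgue_measure R).
Local Notation node i := (i%:R / N%:R : R).
Local Notation bm := bounded_measurable.
Implicit Types v : R -> R.

(** The difference of the two sides is [(`|d| - `|s| / r) ^+ 2 * r]. *)
Lemma young_energy_density (d s r : R) : 0 < r ->
  2 * `|s * d| <= (d ^+ 2 + s ^+ 2 / r ^+ 2) * r.
Proof.
move=> r0; rewrite -subr_ge0.
rewrite (_ : _ - _ = (`|d| - `|s| / r) ^+ 2 * r).
  by rewrite mulr_ge0 ?sqr_ge0// ltW.
rewrite normrM -(real_normK (num_real d)) -(real_normK (num_real s)).
by field; rewrite gt_eqF.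
Qed.

Lemma energy_density_bmS v a b : Skh0 k N v -> 0 <= a -> b <= 1 ->
  bm `[a, b] (energy_density v).
Proof.
move=> /(energy_density_bm N0) + a0 b1; apply: bmS => // x /=.
by rewrite !in_itv/= => /andP[ax xb]; rewrite (le_trans a0)//= (le_trans xb).
Qed.

(** On one cell [v] is a polynomial, so the fundamental theorem of calculus
applies to [cos v]; its derivative is controlled by [young_energy_density]. *)
Lemma energy_bound_cell v i a b : Skh0 k N v -> (i < N)%N ->
  node i <= a -> a <= b -> b <= node i.+1 ->
  2 * `|cos (v b) - cos (v a)| <= \int[mu]_(r in `[a, b]) energy_density v r.
Proof.
move=> Sv iN ia ab bi; have [p [vp dvp]] := Skh0_cell Sv iN.
have a0 : 0 <= a by rewrite (le_trans _ ia)// divr_ge0.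
have b1 : b <= 1.
  by rewrite (le_trans bi)// ler_pdivrMr ?ltr0n// mul1r ler_nat.
have be := energy_density_bmS Sv a0 b1.
rewrite !vp ?in_itv/= ?ia ?bi ?(le_trans ab) ?(le_trans ia)//.
move: ab; rewrite le_eqVlt => /predU1P[<-|ab].
  rewrite subrr normr0 mulr0; apply: Rintegral_ge0 => r.
  rewrite /= in_itv/= => /andP[ar _]; apply: energy_density_ge0.
  exact: le_trans ar.
pose g x := - sin p.[x] * p^`().[x].
have dF (x : R) : is_derive x 1 (cos \o horner p) (g x).
  exact: is_derive1_comp (is_derive_cos _) (is_derive_poly _ _).
have cF : continuous (cos \o horner p).
  move=> x; apply/differentiable_continuous/derivable1_diffP.
  by have [] := dF x.
have cg : continuous g.
  move=> x; apply: cvgM; last exact: continuous_horner.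
  apply: cvgN; apply: (@continuous_cvg _ _ _ _ _ _ sin).
    exact: continuous_sin.
  exact: continuous_horner.
have bg : bm `[a, b] g by apply: bm_continuous; exact: continuous_subspaceT.
have <- : \int[mu]_(x in `[a, b]) g x = cos p.[b] - cos p.[a].
  apply: EFin_inj; rewrite -bm_integral// EFinB.
  apply: (@continuous_FTC2 R g (cos \o horner p) a b ab).
  - by apply: continuous_subspaceT; exact: cg.
  - split; last 2 first.
    + by apply: cvg_at_right_filter; exact: cF.
    + by apply: cvg_at_left_filter; exact: cF.
    + by move=> x _; have [] := dF x.
  - by move=> x _; rewrite derive1E; have [_] := dF x.
have bn : bm `[a, b] (fun x => `|g x|).
  have [mg [M gM]] := bg; split; first exact: measurableT_comp.
  by exists M => x /gM; rewrite normr_id.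
have subI : `]a, b[ `<=` (`[a, b] : set R) by exact: subset_itv_oo_cc.
rewrite (le_trans (ler_wpM2l _ (le_normr_Rintegral _ (bm_integrable bg))))//.
rewrite -RintegralZl//; last exact: bm_integrable.
have Hoo h : bm `[a, b] h ->
    \int[mu]_(r in `[a, b]) h r = \int[mu]_(r in `]a, b[) h r.
  move=> [mh _]; rewrite /Rintegral integral_itv_bndoo//.
  by apply/measurable_EFinP; apply: (measurable_funS _ subI mh).
have bn2 : bm `[a, b] (fun x => 2 * `|g x|) by apply: bmM => //; exact: bm_cst.
rewrite !Hoo//; apply: le_Rintegral => //.
- by apply: integrableS (bm_integrable bn2).
- by apply: integrableS (bm_integrable be).
move=> x xab; have xi : x \in `]node i, node i.+1[.
  move: xab; rewrite /= !in_itv/= => /andP[ax xb].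
  by rewrite (le_lt_trans ia)//= (lt_le_trans xb).
rewrite /energy_density dvp// vp; last exact: subset_itv_oo_cc.
rewrite /g normrM normrN -normrM; apply: young_energy_density.
by move: xi; rewrite in_itv/= => /andP[ix _]; rewrite (le_lt_trans _ ix)// divr_ge0.
Qed.

(** Both sides are additive, respectively subadditive, under concatenation of
intervals, so the estimate propagates from cell to cell. *)
Lemma energy_bound v a b : Skh0 k N v -> 0 <= a -> a <= b -> b <= 1 ->
  2 * `|cos (v b) - cos (v a)| <= \int[mu]_(r in `[a, b]) energy_density v r.
Proof.
move=> Sv a0.
suff H n : (n <= N)%N -> forall b, a <= b -> b <= node n ->
    2 * `|cos (v b) - cos (v a)| <= \int[mu]_(r in `[a, b]) energy_density v r.
  move=> ab b1; apply: (H N) => //.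
  by rewrite divff// gt_eqF// ltr0n.
elim: n => {b} [_|n ih nN] b ab bn.
  apply: (energy_bound_cell (i := 0)) => //; first by rewrite mul0r.
  rewrite (le_trans bn)// ltW//.
  exact: node_lt.
have [bn'|nb] := leP b (node n); first exact: ih (ltnW nN) _ ab bn'.
have [an|na] := leP a (node n); last exact: (energy_bound_cell Sv nN (ltW na) ab bn).
have h1 := ih (ltnW nN) _ an (lexx _).
have h2 := energy_bound_cell Sv nN (lexx _) (ltW nb) bn.
have b1 : b <= 1.
  by rewrite (le_trans bn)// ler_pdivrMr ?ltr0n// mul1r ler_nat.
have be := energy_density_bmS Sv a0 b1.
rewrite -[leRHS](subrK (\int[mu]_(r in `[a, node n]) energy_density v r)).
rewrite Rintegral_itvB ?bnd_simp//; last 2 first.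
- exact: bm_integrable.
- exact: ltW.
rewrite Rintegral_itv_obnd_cbnd; last first.
  apply: integrableS (bm_integrable be) => //.
  by apply: subset_itvr; rewrite bnd_simp.
apply: le_trans (lerD h2 h1); rewrite -mulrDr ler_wpM2l//.
by rewrite (le_trans _ (ler_normD _ _))// addrA subrK.
Qed.

(** The threshold 4 is energy 2, since the density omits the factor 1/2. The
path from 0 to [v r] and back to 0 costs [4 * (1 - cos (v r))]. *)
Lemma energy_le4_normr_lt_pi v r : Skh0 k N v ->
  \int[mu]_(r in `[0, 1]) energy_density v r <= 4 ->
  r \in `[0, 1] -> `|v r| < pi.
Proof.
move=> Sv E4.
have cos_ge0 x : x \in `[0, 1] -> 0 <= cos (v x).
  rewrite in_itv/= => /andP[x0 x1]; have [_ v0 v1 _] := Sv.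
  have h1 := energy_bound Sv (lexx 0) x0 x1.
  have h2 := energy_bound Sv x0 x1 (lexx 1).
  have be := energy_density_bmS Sv (lexx 0) (lexx 1).
  have : 2 * `|cos (v 1) - cos (v x)| + 2 * `|cos (v x) - cos (v 0)| <= 4.
    apply: le_trans E4.
    rewrite -[leRHS](subrK (\int[mu]_(r in `[0, x]) energy_density v r)).
    rewrite Rintegral_itvB ?bnd_simp//; last exact: bm_integrable.
    rewrite Rintegral_itv_obnd_cbnd; first exact: lerD.
    apply: integrableS (bm_integrable be) => //.
    by apply: subset_itvr; rewrite bnd_simp.
  rewrite v0 v1 cos0 (distrC (cos (v x))).
  have := ler_norm (1 - cos (v x)); lra.
rewrite in_itv/= => /andP[r0 r1]; rewrite ltNge; apply/negP => vr.
have [cv v0 _ _] := Sv.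
have cn : {within `[0, r], continuous (fun x => `|v x|)}.
  have : {within `[0, r], continuous v}.
    apply: continuous_subspaceW cv; apply: subset_itvl; rewrite bnd_simp//.
  by move=> c x; apply: cvg_norm; exact: c.
have [|c c0r vc] := @IVT R (fun x => `|v x|) 0 r pi r0 cn.
  by rewrite v0 normr0 ge_min pi_ge0 le_max vr orbT.
have : 0 <= cos (v c).
  apply: cos_ge0; move: c0r; rewrite !in_itv/= => /andP[-> cr].
  exact: le_trans r1.
by rewrite -cos_norm vc cospi oppr_ge0 ler10.
Qed.

End energy_bound.

Lemma normLinf_le (R : realType) (v : R -> R) (M : R) : 0 <= M ->
  (forall r, r \in `[0, 1] -> `|v r| <= M) -> (normLinf v <= M%:E)%E.
Proof.
move=> M0 vM; rewrite /normLinf unlock; case: ifP => _; last by rewrite lee_fin.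
apply/ess_supP; exists (~` `[0, 1]); split.
- by apply: measurableC.
- change ((@lebesgue_measure R) (~` `[0, 1] `&` `[0, 1]) = 0%E).
  by rewrite setICl measure0.
- by move=> r /= nr r01; apply: nr; rewrite lee_fin; exact: vM.
Qed.

Theorem corollary3p2 (R : realType) (k N J : nat) (T : R) (u : nat -> R -> R)
  (hk : (1 <= k)%N) (hN : (0 < N)%N) (hJ : (0 < J)%N) (hT : 0 < T)
  (hu : is_discrete_solution k N J T u)
  (hu0 : energy_class1 (u 0%N)) :
  forall j : nat, (j <= J)%N -> (normLinf (u j) <= pi%:E)%E.
Proof.
move=> j jJ; have [Su _] := hu.
apply: normLinf_le => [|r r01]; first exact: pi_ge0.
apply/ltW/(energy_le4_normr_lt_pi hN (Su j jJ)) => //.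
apply: le_trans (discrete_solution_energy_le hN hT hJ hu jJ) _.
have [_] := hu0; rewrite (Skh0_energyE hN (Su 0 isT)) lee_fin.
lra.
Qed.
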